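(* Let $\mathcal H$ be a complex Hilbert space and let $\mathrm U(\mathcal H)$ be the group of all unitary operators $\mathcal H\to\mathcal H$. Then the compact open topology on $\mathrm U(\mathcal H)$ coincides with the strong topology on $\mathrm U(\mathcal H)$.
   Context: The strong topology on $\mathrm U(\mathcal H)$ is the strong operator topology, i.e. the topology induced by the seminorms $T\mapsto\|Tf\|$, $f\in\mathcal H$, on the space $\mathrm B(\mathcal H)$ of bounded operators. The compact open topology on $\mathrm U(\mathcal H)$ is the topology induced by the seminorms $T\mapsto \|T\|_K:=\sup\{\|Tf\|: f\in K\}$ on $\mathrm B(\mathcal H)$, where $K$ runs over the compact subsets of $\mathcal H$. *)

(* Defs.v *)
From HB Require Import structures.
From mathcomp Require Import all_boot all_order all_algebra.
From mathcomp Require Import sesquilinear complex.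
From mathcomp Require Import all_classical reals topology normedtype.

Set Implicit Arguments.
Unset Strict Implicit.
Unset Printing Implicit Defensive.

Import Order.TTheory GRing.Theory Num.Theory.
Import numFieldNormedType.Exports.

Local Open Scope classical_set_scope.
Local Open Scope ring_scope.
Local Open Scope complex_scope.

Definition open_sets (T : topologicalType) : set (set T) := @open T.
Arguments open_sets : clear implicits.

(* The topology on V induced by a family P of seminorms (R-valued functions).
   The open sets are those containing, around each of their points v, a finite
   intersection of balls {w | p (w - v) < e} with p in P. The finite subset F
   may be empty. *)
Section SeminormTopology.
Context {R : realType} {V : zmodType}.
Implicit Type P : set (V -> R).

Definition seminorm_topology P : Type := V.

Definition seminorm_open P : set (set V) :=
  [set A | forall v, A v ->
    exists (F : set (V -> R)) (e : R),
      [/\ finite_set F, F `<=` P, 0 < e &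
          [set w | forall p, F p -> p (w - v) < e] `<=` A]].

Context (P : set (V -> R)).

Lemma seminorm_openT : seminorm_open P setT.
Proof. by move=> v _; exists set0, 1; split. Qed.

Lemma seminorm_openI : setI_closed (seminorm_open P).
Proof.
move=> A B oA oB v [/oA[F [e [finF FP e0 FA]]] /oB[G [d [finG GP d0 GB]]]].
exists (F `|` G), (Num.min e d); split.
- by rewrite finite_setU.
- by rewrite subUset.
- by rewrite lt_min e0.
- move=> w FGw; split.
  + by apply: FA => p Fp; have /FGw := or_introl Fp : (F `|` G) p;
      rewrite lt_min => /andP[].
  + by apply: GB => p Gp; have /FGw := or_intror Gp : (F `|` G) p;
      rewrite lt_min => /andP[].
Qed.

Lemma seminorm_open_bigU (I : Type) (A : I -> set V) :
  (forall i, seminorm_open P (A i)) -> seminorm_open P (\bigcup_i A i).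
Proof.
move=> oA v [i _ /oA[F [e [finF FP e0 FA]]]].
by exists F, e; split => // w /FA; exists i.
Qed.

HB.instance Definition _ := Choice.on (seminorm_topology P).
HB.instance Definition _ := isOpenTopological.Build (seminorm_topology P)
  seminorm_openT seminorm_openI seminorm_open_bigU.

End SeminormTopology.

(* Norms on a normed module over R[i] take values in R[i]. *)
Definition real_norm {R : realType} {H : normedModType R[i]} (x : H) : R :=
  complex.Re `|x|.

Section BoundedOperators.
Context {R : realType} (H : normedModType R[i]).

Definition is_bounded_operator (T : H -> H) : Prop :=
  linear T /\ exists M : R, forall f, real_norm (T f) <= M * real_norm f.

Definition bounded_operator_pred : {pred H -> H} :=
  [pred T | `[< is_bounded_operator T >]].

Record bounded_operator := BoundedOperator {
  bounded_operator_fun :> H -> H;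
  bounded_operatorP : bounded_operator_fun \in bounded_operator_pred }.

HB.instance Definition _ := [isSub for bounded_operator_fun].
HB.instance Definition _ := [Choice of bounded_operator by <:].

Lemma real_norm_ge0 (x : H) : 0 <= real_norm x.
Proof. by have := normr_ge0 x; rewrite lecE => /andP[]. Qed.

Lemma real_normD (x y : H) : real_norm (x + y) <= real_norm x + real_norm y.
Proof.
by have := ler_normD x y; rewrite lecE => /andP[_]; rewrite raddfD.
Qed.

Lemma real_normE (x : H) : `|x| = (real_norm x)%:C.
Proof.
have := normr_ge0 x; rewrite lecE => /andP[/eqP im0 _].
by rewrite [LHS]complexE -/(real_norm x) im0 mulr0 addr0.
Qed.

Lemma real_normZ (a : R[i]) (x : H) :
  real_norm (a *: x) = complex.Re `|a| * real_norm x.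
Proof.
by rewrite /real_norm normrZ !real_normE normc_def -rmorphM.
Qed.

Lemma bounded_operator_submod : submod_closed bounded_operator_pred.
Proof.
split.
  apply/asboolP; split; first by move=> a x y; rewrite scaler0 addr0.
  exists 0 => f; rewrite mul0r /real_norm.
  by rewrite (_ : (0 : H -> H) f = 0) // normr0.
move=> a S T /asboolP[linS [M SM]] /asboolP[linT [N TN]].
apply/asboolP; split.
  move=> b x y; rewrite !fctE linS linT !scalerDr !scalerA (mulrC a b).
  by rewrite addrACA.
exists (complex.Re `|a| * M + N) => f; rewrite !fctE.
apply: (le_trans (real_normD _ _)); rewrite mulrDl lerD //.
rewrite real_normZ -mulrA ler_wpM2l //.
by have := normr_ge0 a; rewrite lecE => /andP[].
Qed.

HB.instance Definition _ :=
  GRing.isSubmodClosed.Build _ _ bounded_operator_pred bounded_operator_submod.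
HB.instance Definition _ :=
  [SubChoice_isSubLmodule of bounded_operator by <:].

Definition strong_seminorms : set (bounded_operator -> R) :=
  [set (fun T : bounded_operator => real_norm (T f)) | f in [set: H]].

(* sup set0 = 0, so K = set0 contributes the zero seminorm. *)
Definition compact_open_seminorms : set (bounded_operator -> R) :=
  [set (fun T : bounded_operator => sup [set real_norm (T f) | f in K])
     | K in @compact H].

Definition strong_operator_topology : topologicalType :=
  seminorm_topology strong_seminorms.

Definition compact_open_operator_topology : topologicalType :=
  seminorm_topology compact_open_seminorms.

End BoundedOperators.

Section UnitaryOperators.
Context {R : realType} {H : normedModType R[i]}.
Variable dot : {dot H for @Num.conj R[i]}.

Definition unitary_operator : set (bounded_operator H) :=
  [set T | (forall f g, dot (T f) (T g) = dot f g) /\ range T = setT].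

(* Subspace topologies inherited from the space of bounded operators. *)
Definition strong_unitary_topology : topologicalType :=
  initial_topology
    (set_val : set_type unitary_operator -> strong_operator_topology H).

Definition compact_open_unitary_topology : topologicalType :=
  initial_topology
    (set_val : set_type unitary_operator -> compact_open_operator_topology H).

End UnitaryOperators.

(* Main.v *)
Require Import Defs.
From mathcomp Require Import all_boot all_order all_algebra.
From mathcomp Require Import sesquilinear complex.
From mathcomp Require Import all_classical reals topology normedtype.
From mathcomp Require Import lra.

Import Order.TTheory GRing.Theory Num.Theory.
Import numFieldNormedType.Exports.

Local Open Scope classical_set_scope.
Local Open Scope ring_scope.
Local Open Scope complex_scope.

(** Singletons are compact, so every strong seminorm is a compact open one.
    Conversely, unitary operators are 1-Lipschitz, so for unitary [v] and [w]
    the map [f |-> |(w - v) f|] is 2-Lipschitz. Hence if [w] is strongly close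
    to [v] at a point [f], it is also close to [v] on a ball around [f] whose
    radius does not depend on [w], and compactness makes this uniform on
    compact sets. *)

Lemma seminorm_openS {R : realType} {V : zmodType} (P Q : set (V -> R)) :
  P `<=` Q -> seminorm_open P `<=` seminorm_open Q.
Proof.
move=> PQ A oA v /oA[F [e [finF FP e0 FA]]].
by exists F, e; split => //; exact: subset_trans PQ.
Qed.

Section Operators.
Context {R : realType} {H : normedModType R[i]}.
Implicit Types v w : bounded_operator H.

Lemma bounded_operatorB v (x y : H) : v (x - y) = v x - v y.
Proof.
have /asboolP[linv _] := bounded_operatorP v.
by rewrite -scaleN1r addrC linv scaleN1r addrC.
Qed.

Lemma strong_sub_compact_open_seminorms :
  @strong_seminorms R H `<=` @compact_open_seminorms R H.
Proof.
move=> _ [f _ <-]; exists [set f]; first exact: compact_set1.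
by apply/funext => v; rewrite image_set1 sup1.
Qed.

(** The set of such [w] is open: by the triangle inequality, each of its points [w] keeps a margin
    of [e - real_norm (w f - v f)]. *)
Lemma strong_nbhs_ball v (f : H) (e : R) : 0 < e ->
  \forall w \near (v : strong_operator_topology H),
    real_norm ((w : bounded_operator H) f - v f) < e.
Proof.
move=> e0; apply: open_nbhs_nbhs; split; last first.
  by rewrite /= subrr /real_norm normr0.
move=> w /= we.
exists [set fun T : bounded_operator H => real_norm (T f)],
  (e - real_norm (w f - v f)); split.
- exact: finite_set1.
- by move=> _ ->; exists f.
- by rewrite subr_gt0.
- move=> u /(_ _ erefl) /= uw.
  have {uw} : real_norm (u f - w f) < e - real_norm (w f - v f) by [].
  have := real_normD (u f - w f) (w f - v f).
  by rewrite addrA subrK; lra.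
Qed.

Variable dot : {dot H for @Num.conj R[i]}.
Hypothesis dot_norm : forall f : H, dot f f = `|f| ^+ 2.

Lemma unitary_norm v : unitary_operator dot v ->
  forall f : H, real_norm (v f) = real_norm f.
Proof.
move=> [dotv _] f; congr complex.Re.
have := dotv f f; rewrite !dot_norm => /eqP.
by rewrite eqrXn2 // => /eqP.
Qed.

(** Unitarity of [w] is a premise inside the filter because neighbourhoods of [v] are taken among
    all bounded operators. *)
Lemma strong_near_compact v (K : set H) (e : R) :
  unitary_operator dot v -> compact K -> 0 < e ->
  \forall w \near (v : strong_operator_topology H),
    unitary_operator dot w -> K `<=` [set x | real_norm (w x - v x) < e].
Proof.
move=> Uv /compact_near_coveringP cK e0.
(* Three terms below [e / 4] will bound [w y - v y]: [w y - w x], [w x - v x] and [v x - v y]. *)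
have e4 : 0 < e / 4 by lra.
pose P (w : strong_operator_topology H) (x : H) :=
  unitary_operator dot w ->
  real_norm ((w : bounded_operator H) x - v x) < e.
(* The near-covering form of compactness reduces uniformity on [K] to a claim near each point,
   jointly in point and operator. *)
suff /(cK _ _ P _) : forall x, K x ->
    \forall x' \near x & w \near (v : strong_operator_topology H), P w x'.
  by apply: filterS => w KP Uw x /KP; exact.
move=> x _.
exists ([set y | real_norm (x - y) < e / 4],
  [set w : strong_operator_topology H |
     real_norm ((w : bounded_operator H) x - v x) < e / 4]).
  split => /=; last exact: strong_nbhs_ball.
  apply/nbhs_normP; exists (e / 4)%:C; first by rewrite /= ltcR.
  by move=> y; rewrite /ball_ /= real_normE ltcR.
move=> [y w] /= [xy wx] Uw.
have wxy : real_norm (w x - w y) < e / 4.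
  by rewrite -bounded_operatorB unitary_norm.
have vxy : real_norm (v x - v y) < e / 4.
  by rewrite -bounded_operatorB unitary_norm.
have symN (a b : H) : real_norm (a - b) = real_norm (b - a).
  by rewrite /real_norm distrC.
have := real_normD (w y - w x) (w x - v x).
have := real_normD (w y - v x) (v x - v y).
rewrite !addrA !subrK (symN (w y) (w x)); lra.
Qed.

Lemma strong_near_compact_open_seminorm v (p : bounded_operator H -> R)
    (e : R) :
  unitary_operator dot v -> compact_open_seminorms p -> 0 < e ->
  \forall w \near (v : strong_operator_topology H),
    unitary_operator dot w -> p (w - v) < e.
Proof.
(* A supremum preserves only non-strict bounds, so [e / 2] leaves room for the strict one. *)
move=> Uv [K cK <-] e0; have e2 : 0 < e / 2 by lra.
have := strong_near_compact _ _ _ Uv cK e2; apply: filterS => w wK Uw.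
(* [ge_sup] needs a nonempty set; for empty [K] the seminorm is 0. *)
have [->|/set0P[x Kx]] := eqVneq K set0; first by rewrite image_set0 sup0.
apply: (@le_lt_trans _ _ (e / 2)); last by lra.
apply: ge_sup; first by exists (real_norm ((w - v) x)), x.
by move=> _ [y Ky <-]; apply/ltW/(wK Uw y Ky).
Qed.

Lemma strong_nbhs_compact_open v (B : set (bounded_operator H)) :
  unitary_operator dot v -> seminorm_open (@compact_open_seminorms R H) B ->
  B v ->
  \forall w \near (v : strong_operator_topology H),
    unitary_operator dot w -> B w.
Proof.
move=> Uv oB /oB[F [e [/finite_fsetP[X ->] FP e0 FB]]].
(* Only finitely many seminorms occur, so their neighbourhoods can be intersected. *)
have := @filter_bigI _ _ X
  (fun p => [set w | unitary_operator dot w -> p (w - v) < e])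
  (nbhs (v : strong_operator_topology H)) _ _.
move=> /(_ _ (fun p pX =>
  strong_near_compact_open_seminorm _ _ _ Uv (FP p pX) e0)).
by apply: filterS => w wX Uw; apply: FB => p pX; exact: wX.
Qed.

End Operators.

Theorem proposition2 (R : realType) (H : completeNormedModType R[i])
    (dot : {dot H for @Num.conj R[i]})
    (dot_norm : forall f : H, dot f f = `|f| ^+ 2) :
  open_sets (compact_open_unitary_topology dot) =
  open_sets (strong_unitary_topology dot) :> set (set (unitary_operator dot)).
Proof.
apply/seteqP; split => A.
  move=> [B oB <-].
  (* [B] itself need not be strongly open; this interior is, and it has the same trace on the
     unitary operators. *)
  exists (interior ([set w | unitary_operator dot w -> B w]
                      : set (strong_operator_topology H))).
    exact: open_interior.
  apply/seteqP; split => u /=.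
    by move=> /interior_subset; apply; exact: set_valP.
  move=> Bu; apply: (strong_nbhs_compact_open dot dot_norm) => //.
  exact: set_valP.
move=> [B oB <-]; exists B => //.
exact: seminorm_openS (@strong_sub_compact_open_seminorms R H) _ oB.
Qed.
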